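(* Let $r\ge 3$ be an integer. (i) If $r\equiv 0$ or $2\pmod 3$, then there is a bijection $\tau:F^r\to F^r$ such that $S_{\mathcal H,\tau}$ is a propelinear extended perfect code of length $2^{r+1}$ with $\mathrm{rank}(S_{\mathcal H,\tau})=2^{r+1}-2$ and $\dim(\mathrm{Ker}(S_{\mathcal H,\tau}))=2^{r+1}-2r-2$. (ii) If $r\equiv 1\pmod 3$, then there is a bijection $\tau:F^r\to F^r$ such that $S_{\mathcal H,\tau}$ is a propelinear extended perfect code of length $2^{r+1}$ with $\mathrm{rank}(S_{\mathcal H,\tau})=2^{r+1}-2$ and $\dim(\mathrm{Ker}(S_{\mathcal H,\tau}))=2^{r+1}-2r-1$, and there is a bijection $\tau:F^r\to F^r$ such that $S_{\mathcal H,\tau}$ is a propelinear extended perfect code (of length $2^{r+1}$) with $\mathrm{rank}(S_{\mathcal H,\tau})=2^{r+1}-3$ and $\dim(\mathrm{Ker}(S_{\mathcal H,\tau}))=2^{r+1}-2r-2$.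
   Context: $F=\mathrm{GF}(2)$; $F^n$ carries the Hamming metric; a code of length $n$ is a set of vectors of $F^n$, whose elements are called codewords. $\mathrm{wt}$ is Hamming weight. ${\bf 0}$ denotes the all-zero vector. A code $C\subseteq F^n$ is perfect if for every $x\in F^n$ there is exactly one $y\in C$ at Hamming distance at most $1$ from $x$. An extended perfect code is obtained from a perfect code by adding an overall parity check coordinate to all codewords (its position is immaterial). The rank of a code is the dimension of its linear span over $F$. The kernel $\mathrm{Ker}(C)$ of a code $C$ of length $n$ is the set of all $x\in F^n$ with $x+C=C$ (a linear subspace). $\mathrm{Aut}(F^n)$ is the group of all transformations $(x,\pi)$, $x\in F^n$, $\pi$ a permutation of the coordinate positions, acting by $(x,\pi)(y)=x+\pi(y)$ where $\pi(y)=(y_{\pi^{-1}(1)},\ldots,y_{\pi^{-1}(n)})$. $\mathrm{Aut}(C)$ is the setwise stabilizer of $C$ in $\mathrm{Aut}(F^n)$. A code $C$ is propelinear if $\mathrm{Aut}(C)$ has a subgroup of order $|C|$ acting transitively on the codewords of $C$. The coordinates of $F^{2^r}$ are indexed by the vectors of $F^r$; $e_a$ is the vector whose only nonzero coordinate is the one indexed by $a$; $\mathcal H=\{c\in F^{2^r}:\sum_{a:c_a=1}a={\bf 0},\ \mathrm{wt}(c)\equiv 0 \pmod 2\}$ and $\mathcal H_a=\mathcal H+e_a+e_{\bf 0}$ for $a\in F^r$. For a bijection $\tau:F^r\to F^r$, $S_{\mathcal H,\tau}=\bigcup_{a\in F^r}\mathcal H_a\times\mathcal H_{\tau(a)}$,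 where $C\times D=\{x|y:x\in C,y\in D\}$ and $x|y$ is concatenation. *)

(* Defs.v *)
From HB Require Import structures.
From mathcomp Require Import all_boot all_order all_algebra all_fingroup.

Set Implicit Arguments.
Unset Strict Implicit.
Unset Printing Implicit Defensive.

Import GRing.Theory.
Local Open Scope ring_scope.

(* Coordinate positions range over an arbitrary finite type I, so that F^(2^r)
   is literally indexed by the vectors of F^r.  The regular module ('F_2)^o
   (convertible to 'F_2) gives words their vector space structure. *)
Definition word (I : finType) := {ffun I -> ('F_2)^o}.

Definition code (I : finType) := {set word I}.

Definition code_length (I : finType) (C : code I) : nat := #|I|.

Definition wt (I : finType) (x : word I) : nat := #|[set i | x i != 0]|.

Definition hdist (I : finType) (x y : word I) : nat :=
  #|[set i | x i != y i]|.

Definition perfect (I : finType) (C : code I) : Prop :=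
  forall x : word I, exists! y : word I, y \in C /\ (hdist x y <= 1)%N.

(* Adds a parity check at position p to a word on the other positions. *)
Definition parity_extend (I : finType) (p : I)
    (c : word {i : I | i != p}) : word I :=
  [ffun i => if insub i is Some j then c j else \sum_j c j].

Definition extended_perfect (I : finType) (C : code I) : Prop :=
  exists (p : I) (P : code {i : I | i != p}),
    perfect P /\ C = [set parity_extend c | c in P].

Definition rank (I : finType) (C : code I) : nat := \dim <<enum C>>%VS.

Definition Ker (I : finType) (C : code I) : code I :=
  [set x : word I | [set x + c | c in C] == C].

Lemma KerD (I : finType) (C : code I) (x y : word I) :
  x \in Ker C -> y \in Ker C -> x + y \in Ker C.
Proof.
rewrite !inE => /eqP Cx /eqP Cy; apply/eqP; rewrite -[RHS]Cx -[in RHS]Cy.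
by rewrite -imset_comp; apply: eq_imset => c /=; rewrite addrA.
Qed.

Lemma Ker0 (I : finType) (C : code I) : 0 \in Ker C.
Proof.
rewrite inE; apply/eqP/setP => c; apply/imsetP/idP => [[d dC ->]|cC].
  by rewrite add0r.
by exists c; rewrite ?add0r.
Qed.

Definition dim_Ker (I : finType) (C : code I) : nat := \dim <<enum (Ker C)>>%VS.

(* The kernel is a subspace, so dim_Ker is its dimension. *)
Lemma mem_span_Ker (I : finType) (C : code I) (x : word I) :
  (x \in <<enum (Ker C)>>%VS) = (x \in Ker C).
Proof.
apply/idP/idP => [/coord_span -> | xK]; last by rewrite memv_span ?mem_enum.
apply: (big_ind (fun y => y \in Ker C)) => [|y z|i _].
  exact: Ker0.
  exact: KerD.
have : (enum (Ker C))`_i \in Ker C by rewrite -mem_enum mem_nth -?cardE.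
move: (coord _ _ _) => [[|[|//]] /= k2] yK.
  by rewrite (_ : Ordinal k2 = 0) ?scale0r ?Ker0 //; apply/val_inj.
by rewrite (_ : Ordinal k2 = 1) ?scale1r //; apply/val_inj.
Qed.

Definition isom_fun (I : finType) (x : word I) (p : {perm I}) (y : word I) :
    word I :=
  x + [ffun i => y (p^-1%g i)].

Lemma isom_fun_inj (I : finType) (x : word I) (p : {perm I}) :
  injective (isom_fun x p).
Proof.
move=> y z /addrI /ffunP yz; apply/ffunP => i.
by have := yz (p i); rewrite !ffunE permK.
Qed.

(* The transformation (x, p), as a permutation of the set of words. *)
Definition isom (I : finType) (x : word I) (p : {perm I}) : {perm word I} :=
  perm (@isom_fun_inj I x p).

Definition AutF (I : finType) : {set {perm word I}} :=
  [set isom u.1 u.2 | u : word I * {perm I}].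

Definition Aut_code (I : finType) (C : code I) : {set {perm word I}} :=
  [set g in AutF I | [set g c | c in C] == C].

Definition propelinear (I : finType) (C : code I) : Prop :=
  exists G : {group {perm word I}},
    [/\ G \subset Aut_code C, #|G| = #|C| & [transitive G, on C | 'P]].

Definition unit_word (I : finType) (a : I) : word I := [ffun i => (i == a)%:R].

Definition hamming (r : nat) : code 'rV['F_2]_r :=
  [set c : word 'rV['F_2]_r
     | (\sum_(a | c a == 1) a == 0) && (wt c == 0 %[mod 2])].

Definition hamming_shift (r : nat) (a : 'rV['F_2]_r) : code 'rV['F_2]_r :=
  let e : 'rV['F_2]_r -> word 'rV['F_2]_r := @unit_word 'rV['F_2]_r in
  [set c + e a + e 0 | c : word 'rV['F_2]_r in hamming r].

Definition concat (I J : finType) (x : word I) (y : word J) : word (I + J)%type :=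
  [ffun k => match k with inl i => x i | inr j => y j end].

Definition code_prod (I J : finType) (C : code I) (D : code J) :
    code (I + J)%type :=
  [set concat x y | x in C, y in D].

Definition S_code (r : nat) (tau : 'rV['F_2]_r -> 'rV['F_2]_r) :
    code ('rV['F_2]_r + 'rV['F_2]_r)%type :=
  \bigcup_(a : 'rV['F_2]_r) code_prod (hamming_shift a) (hamming_shift (tau a)).

(* Main.v *)
(* Let s(c) be the sum of the positions a with c_a = 1, so that S_{H,tau} consists
   of the words x|y with x and y of even weight and s(y) = tau(s(x)): it is the
   preimage of the graph of tau under a linear surjection from a space of dimension
   2^(r+1) - 2 onto F^(2r).  Hence its rank and the dimension of its kernel exceed
   by 2^(r+1) - 2r - 2 the rank of the graph and the dimension of its group of
   periods.
   A regular subgroup of the affine group of F^r amounts to a group law op on F^r,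
   with neutral element 0, whose left translations are affine (a brace).  If tau is
   an isomorphism between two such laws, then the maps (z, pi_z), z in S_{H,tau},
   where pi_z permutes the two halves of the positions by the left translations by
   s(x) and s(y), form a group acting regularly on S_{H,tau}.
   Direct products of isomorphisms add the dimensions above, so that an example
   with full rank and no period for r = 3 reduces the theorem to r = 3, 4, 5, where
   explicit pairs of regular subgroups (found by computer search) are checked. *)
From HB Require Import structures.
Require Import Defs.
From mathcomp Require Import all_boot all_order all_algebra all_fingroup.
From mathcomp Require Import zify.

Set Implicit Arguments.
Unset Strict Implicit.
Unset Printing Implicit Defensive.

Import GRing.Theory.
Local Open Scope ring_scope.

(** * Words, syndromes and the code *)

Lemma F2_cases (x : 'F_2) : x = 0 \/ x = 1.
Proof.
by case: x => [[|[|//]] /= ltx2]; [left | right]; apply/val_inj.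
Qed.

Lemma F2_neqD1 (x y : 'F_2) : x != y -> y = x + 1.
Proof. by case: (F2_cases x) (F2_cases y) => -> [] -> // _; apply/val_inj. Qed.

Lemma F2_addrr (V : lmodType 'F_2) (v : V) : v + v = 0.
Proof. by rewrite -mulr2n -scaler_nat (_ : 2%:R = 0) ?scale0r //; apply/val_inj. Qed.

Lemma F2_oppr (V : lmodType 'F_2) (v : V) : - v = v.
Proof. by apply/esym/eqP; rewrite -addr_eq0 F2_addrr. Qed.

Lemma F2_addr_eq (V : lmodType 'F_2) (u v w : V) : (u + v == w) = (v == u + w).
Proof. by rewrite -(inj_eq (addrI u)) addrA F2_addrr add0r. Qed.

Section Syndromes.
Variable r : nat.
Notation V := 'rV['F_2]_r.

Definition parity (I : finType) (c : word I) : ('F_2)^o := \sum_i c i.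

(** The syndrome for the check matrix whose columns are all vectors of [V]; together with [parity]
    it cuts out the extended Hamming code. *)
Definition synd (c : word V) : V := \sum_a (c a : 'F_2) *: a.

Definition left_word (I J : finType) (z : word (I + J)%type) : word I :=
  [ffun i => z (inl i)].

Definition right_word (I J : finType) (z : word (I + J)%type) : word J :=
  [ffun j => z (inr j)].

Lemma parity_is_linear (I : finType) : linear (@parity I).
Proof.
move=> k x y; rewrite /parity scaler_sumr -big_split; apply: eq_bigr => i _.
by rewrite !ffunE.
Qed.
HB.instance Definition _ (I : finType) :=
  GRing.isLinear.Build 'F_2 (word I) ('F_2)^o _ (@parity I) (@parity_is_linear I).

Lemma synd_is_linear : linear synd.
Proof.
move=> k x y; rewrite /synd scaler_sumr -big_split; apply: eq_bigr => i _.
by rewrite !ffunE scalerDl scalerA.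
Qed.
HB.instance Definition _ :=
  GRing.isLinear.Build 'F_2 (word V) V _ synd synd_is_linear.

Lemma left_word_is_linear (I J : finType) : linear (@left_word I J).
Proof. by move=> k x y; apply/ffunP => i; rewrite !ffunE. Qed.
HB.instance Definition _ (I J : finType) :=
  GRing.isLinear.Build 'F_2 (word (I + J)%type) (word I) _ (@left_word I J)
    (@left_word_is_linear I J).

Lemma right_word_is_linear (I J : finType) : linear (@right_word I J).
Proof. by move=> k x y; apply/ffunP => i; rewrite !ffunE. Qed.
HB.instance Definition _ (I J : finType) :=
  GRing.isLinear.Build 'F_2 (word (I + J)%type) (word J) _ (@right_word I J)
    (@right_word_is_linear I J).

Lemma left_word_concat (I J : finType) (x : word I) (y : word J) :
  left_word (concat x y) = x.
Proof. by apply/ffunP => i; rewrite !ffunE. Qed.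

Lemma right_word_concat (I J : finType) (x : word I) (y : word J) :
  right_word (concat x y) = y.
Proof. by apply/ffunP => i; rewrite !ffunE. Qed.

Lemma concat_parts (I J : finType) (z : word (I + J)%type) :
  concat (left_word z) (right_word z) = z.
Proof. by apply/ffunP => -[i|j]; rewrite !ffunE. Qed.

Lemma parity_unit (I : finType) (a : I) : parity (unit_word a) = 1.
Proof.
rewrite /parity (bigD1 a) //= big1 ?addr0 => [|i /negPf ia]; rewrite ffunE ?ia //.
by rewrite eqxx.
Qed.

Lemma parity_scale_unit (I : finType) (k : 'F_2) (a : I) :
  parity (k *: unit_word a) = k.
Proof. by rewrite linearZ /= parity_unit; apply: mulr1. Qed.

Lemma synd_unit (a : V) : synd (unit_word a) = a.
Proof.
rewrite /synd (bigD1 a) //= big1 ?addr0 => [|i /negPf ia]; rewrite ffunE.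
  by rewrite eqxx scale1r.
by rewrite ia scale0r.
Qed.

Lemma wt_parity (I : finType) (c : word I) : (wt c)%:R = parity c :> 'F_2.
Proof.
rewrite /wt -sum1_card natr_sum big_mkcond; apply: eq_bigr => i _ /=.
by rewrite inE; case: (F2_cases (c i)) => ->.
Qed.

Lemma F2_natr_eq0 (n : nat) : ((n%:R : 'F_2) == 0) = (n == 0 %[mod 2])%N.
Proof. by rewrite mod0n modn2 -val_eqE /= val_Fp_nat //= modn2. Qed.

Lemma mem_hamming (c : word V) : (c \in hamming r) = (synd c == 0) && (parity c == 0).
Proof.
rewrite inE -F2_natr_eq0 wt_parity; congr (_ && _); congr (_ == 0).
rewrite /synd big_mkcond; apply: eq_bigr => a _.
by case: (F2_cases (c a)) => ->; rewrite ?scale0r ?scale1r.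
Qed.

(** Adding [unit_word a + unit_word 0] moves the syndrome by [a] and keeps the parity, so the
    syndrome labels the cosets of [hamming r] among the even words. *)
Lemma mem_hamming_shift (a : V) (c : word V) :
  (c \in hamming_shift a) = (synd c == a) && (parity c == 0).
Proof.
apply/imsetP/andP => [[d] | [/eqP sc pc]].
  rewrite mem_hamming => /andP[/eqP sd /eqP pd] ->.
  rewrite /= !linearD /= !parity_unit !synd_unit sd pd.
  by rewrite add0r addr0 add0r eqxx F2_addrr.
exists (c + unit_word 0 + unit_word a).
  rewrite mem_hamming !linearD /= !parity_unit !synd_unit sc addr0 F2_addrr.
  by rewrite -addrA F2_addrr addr0 eqxx.
by rewrite /= -!addrA [unit_word a + (_ + _)]addrA F2_addrr add0r F2_addrr addr0.
Qed.

Lemma mem_S_code (tau : V -> V) (z : word (V + V)%type) :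
  (z \in S_code tau) =
    [&& parity (left_word z) == 0, parity (right_word z) == 0
      & synd (right_word z) == tau (synd (left_word z))].
Proof.
apply/bigcupP/and3P => [[a _ /imset2P[x y]]|[pl pr /eqP st]].
  rewrite !mem_hamming_shift => /andP[/eqP sx px] /andP[/eqP sy py] ->.
  by rewrite left_word_concat right_word_concat sx sy.
exists (synd (left_word z)) => //; apply/imset2P.
exists (left_word z) (right_word z); rewrite ?mem_hamming_shift ?pl ?pr ?st ?eqxx //.
by rewrite concat_parts.
Qed.

End Syndromes.

(** * Extended perfect codes *)

Section Extension.
Variables (I : finType) (p : I).
Implicit Types (z : word I) (c : word {i | i != p}).

Definition puncture z : word {i | i != p} := [ffun j => z (val j)].

Lemma parity_splitE z : parity z = z p + parity (puncture z).
Proof.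
rewrite /parity (bigD1 p) //=; congr (_ + _).
rewrite (reindex_omap (val : {i | i != p} -> I) insub) => [|i ip].
  by apply: eq_big => [j|j _]; rewrite ?ffunE // valK eqxx (valP j).
by rewrite insubT.
Qed.

Lemma puncture_extend c : puncture (parity_extend c) = c.
Proof. by apply/ffunP => j; rewrite !ffunE valK. Qed.

Lemma extend_puncture z : parity z = 0 -> parity_extend (puncture z) = z.
Proof.
rewrite parity_splitE => /eqP; rewrite addr_eq0 F2_oppr => /eqP zp.
apply/ffunP => i; rewrite ffunE; case: insubP => [j _ <-|]; first by rewrite ffunE.
by rewrite negbK => /eqP ->; rewrite zp.
Qed.

Lemma parity_extend0 c : parity (parity_extend c) = 0.
Proof.
rewrite parity_splitE puncture_extend ffunE insubF ?eqxx //.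
exact: F2_addrr.
Qed.

Lemma hdist_puncture z1 z2 (i : I) :
  z2 + unit_word p = z1 + unit_word i -> (hdist (puncture z1) (puncture z2) <= 1)%N.
Proof.
move=> z12; apply/card_le1_eqP => j k; rewrite !inE !ffunE.
suff H (l : {i | i != p}) : z1 (val l) != z2 (val l) -> val l = i.
  by move=> /H ji /H ki; apply/val_inj; rewrite ji ki.
move/ffunP/(_ (val l)): z12; rewrite !ffunE (negPf (valP l)) addr0 => ->.
by have [//|_] := eqVneq (val l) i; rewrite addr0 eqxx.
Qed.

(** Even words are determined by their punctured parts. The position [i] is the one where these
    differ, or [p] when they agree, the two units then cancelling. *)
Lemma hdist_puncture_unit z1 z2 :
  parity z1 = 0 -> parity z2 = 0 ->
  (hdist (puncture z1) (puncture z2) <= 1)%N ->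
  exists i, z2 = z1 + unit_word p + unit_word i.
Proof.
move=> p1 p2 /card_le1_eqP d12.
suff [i z2E] : exists i, puncture z2 = puncture (z1 + unit_word p + unit_word i).
  exists i; rewrite -[LHS]extend_puncture // z2E extend_puncture //.
  by rewrite !linearD /= !parity_unit p1 add0r F2_addrr.
have [z12|] := eqVneq (puncture z1) (puncture z2).
  by exists p; rewrite -z12 -addrA F2_addrr addr0.
move/eqP/ffunP => nz12.
have [j zj] : exists j, puncture z1 j != puncture z2 j.
  apply/existsP; rewrite -negb_forall; apply/forallP => z12.
  by apply: nz12 => j; apply/eqP.
exists (val j); apply/ffunP => k; rewrite !ffunE (negPf (valP k)) addr0.
have [/val_inj kj|] := eqVneq (val k) (val j).
  by rewrite kj; move: zj; rewrite !ffunE => /F2_neqD1 ->.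
move=> kj; rewrite addr0; apply/esym/eqP; apply: contraNT kj => zk.
by rewrite (d12 k j) ?inE ?ffunE //; move: zj; rewrite !ffunE.
Qed.

(** Decoding a punctured word within distance 1 is the same as correcting a single error in an odd
    word, so the second hypothesis is perfectness of the code punctured at [p]. *)
Lemma extended_perfect_even (C : code I) :
  {in C, forall z, parity z = 0} ->
  (forall z, parity z = 1 -> exists! i, z + unit_word i \in C) ->
  extended_perfect C.
Proof.
move=> evenC oneC; exists p, [set c | parity_extend c \in C]; split; last first.
  apply/setP => z; apply/idP/imsetP => [zC|[c]]; last by rewrite inE => cC ->.
  by exists (puncture z); rewrite ?inE extend_puncture // evenC.
(* Flipping position [p] of the even extension makes it odd. The candidates within distance 1 of [x]
   are the punctured words [z + unit_word i], and [i = p] returns [x] itself. *)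
move=> x; pose z := parity_extend x + unit_word p.
have [|i [ziC iP]] := oneC z.
  by rewrite linearD /= parity_unit parity_extend0 add0r.
have pz : parity (z + unit_word i) = 0 by exact: evenC.
exists (puncture (z + unit_word i)); split.
  rewrite inE extend_puncture //; split=> //.
  rewrite -[x]puncture_extend; apply: (@hdist_puncture _ _ i).
  by rewrite addrAC /z -(addrA (parity_extend x)) F2_addrr addr0.
move=> y []; rewrite inE => yC.
rewrite -[x]puncture_extend -[y]puncture_extend.
case/(hdist_puncture_unit (parity_extend0 x) (parity_extend0 y)) => j yE.
by rewrite yE -/z (iP j) // -yE.
Qed.

End Extension.

(** Exactly one half of an odd word is odd, so the flipped position lies in that half. There it
    changes the syndrome by its own index, and the graph equation, solved through [tau] or its
    inverse, determines this index. *)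
Lemma S_code_extended_perfect (r : nat) (tau : 'rV['F_2]_r -> 'rV['F_2]_r) :
  bijective tau -> extended_perfect (S_code tau).
Proof.
move=> [tau' tauK tau'K].
have par2 (z : word ('rV['F_2]_r + 'rV['F_2]_r)%type) :
    parity z = parity (left_word z) + parity (right_word z).
  rewrite /parity big_sumType /=.
  by congr (_ + _); apply: eq_bigr => i _; rewrite ffunE.
have lr (i j : 'rV['F_2]_r) :
  [/\ left_word (unit_word (inl i : 'rV['F_2]_r + 'rV['F_2]_r)%type) = unit_word i,
      right_word (unit_word (inl i : 'rV['F_2]_r + 'rV['F_2]_r)%type) = 0,
      left_word (unit_word (inr j : 'rV['F_2]_r + 'rV['F_2]_r)%type) = 0
    & right_word (unit_word (inr j : 'rV['F_2]_r + 'rV['F_2]_r)%type) = unit_word j].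
  by split; apply/ffunP => k; rewrite !ffunE.
apply: (extended_perfect_even (inl 0)) => [z|z pz].
  by rewrite mem_S_code par2 => /and3P[/eqP -> /eqP -> _]; rewrite addr0.
have memi i : (z + unit_word i \in S_code tau) =
  match i with
  | inl a => [&& parity (left_word z) == 1, parity (right_word z) == 0
               & a == synd (left_word z) + tau' (synd (right_word z))]
  | inr b => [&& parity (left_word z) == 0, parity (right_word z) == 1
               & b == synd (right_word z) + tau (synd (left_word z))]
  end.
  case: i => i; rewrite mem_S_code !linearD /=; have [l1 l2 l3 l4] := lr i i.
    rewrite l1 l2 parity_unit linear0 addr0 addr_eq0 F2_oppr synd_unit linear0 addr0.
    by rewrite -(can2_eq tau'K tauK) [tau' _ == _]eq_sym F2_addr_eq.
  rewrite l3 l4 parity_unit linear0 addr0 addr_eq0 F2_oppr synd_unit linear0 addr0.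
  by rewrite F2_addr_eq.
move: pz; rewrite par2.
case: (F2_cases (parity (left_word z))) => pl;
  case: (F2_cases (parity (right_word z))) => pr.
- by rewrite pl pr.
- exists (inr (synd (right_word z) + tau (synd (left_word z)))); split=> [|[a|b]].
  + by rewrite memi pl pr !eqxx.
  + by rewrite memi pl.
  + by rewrite memi pl pr => /eqP ->.
- exists (inl (synd (left_word z) + tau' (synd (right_word z)))); split=> [|[a|b]].
  + by rewrite memi pl pr !eqxx.
  + by rewrite memi pl pr => /eqP ->.
  + by rewrite memi pl.
- by rewrite pl pr.
Qed.

(** * Propelinear structures from braces *)

(* The last condition says that [op a] is affine, since [op a 0 = a]. *)
Definition brace (V : zmodType) (op : V -> V -> V) : Prop :=
  [/\ right_id 0 op, associative op, forall a, injective (op a)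
    & forall a x y, op a (x + y) = op a x - a + op a y].

Lemma brace_left_id (V : zmodType) (op : V -> V -> V) :
  brace op -> left_id 0 op.
Proof. by case=> op0 opA opI _ x; apply: (opI 0); rewrite opA op0. Qed.

Lemma brace_morph0 (V : zmodType) (op1 op2 : V -> V -> V) (tau : V -> V) :
  brace op1 -> brace op2 -> {morph tau : x y / op1 x y >-> op2 x y} ->
  tau 0 = 0.
Proof.
case=> op0 _ _ _ [op0' _ opI _] tauM.
by apply: (opI (tau 0)); rewrite -tauM op0 op0'.
Qed.

Section Permuted.
Variable r : nat.
Notation V := 'rV['F_2]_r.

Definition permute_word (I : finType) (p : {perm I}) (c : word I) : word I :=
  [ffun i => c (p^-1%g i)].

Lemma parity_permute (I : finType) (p : {perm I}) (c : word I) :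
  parity (permute_word p c) = parity c.
Proof.
rewrite /parity (reindex_inj (@perm_inj _ p)).
by apply: eq_bigr => i _; rewrite ffunE permK.
Qed.

(** Write [op a x] as [L x + a] with [L] additive, hence linear over the two-element field.
    Permuting positions by [op a] applies [L] to the syndrome and adds [parity c] times [a], which
    is zero. *)
Lemma synd_permute (op : V -> V -> V) (a : V) (p : {perm V}) (c : word V) :
  brace op -> p =1 op a -> parity c = 0 ->
  synd (permute_word p c) = op a (synd c) - a.
Proof.
case=> op0 _ _ opD pE pc; pose L x := op a x - a.
have LD : {morph L : x y / x + y} by move=> x y; rewrite /L opD -addrA.
have L0 : L 0 = 0 by rewrite /L op0 subrr.
have LZ (k : 'F_2) x : L (k *: x) = k *: L x.
  by case: (F2_cases k) => ->; rewrite ?scale0r ?scale1r.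
rewrite -/(L (synd c)) /synd (big_morph L LD L0) (reindex_inj (@perm_inj _ p)).
pose F x := (c x : 'F_2) *: op a x - (c x : 'F_2) *: a.
rewrite [RHS](eq_bigr F) => [|x _].
  rewrite sumrB -scaler_suml -/(parity c) pc scale0r subr0.
  by apply: eq_bigr => x _; rewrite ffunE permK pE.
by rewrite LZ /L scalerBr.
Qed.

Variables (op1 op2 : V -> V -> V) (tau : V -> V).
Hypotheses (br1 : brace op1) (br2 : brace op2).
Hypothesis tauM : {morph tau : x y / op1 x y >-> op2 x y}.

Notation W := (word (V + V)%type).
Let S := S_code tau.

Definition sum_op (a b : V) (k : V + V) : V + V :=
  match k with inl x => inl (op1 a x) | inr y => inr (op2 b y) end.

Lemma sum_op_inj a b : injective (sum_op a b).
Proof.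
case: br1 br2 => _ _ I1 _ [_ _ I2 _].
by move=> [x|y] [x'|y'] //= [] => [/I1|/I2] ->.
Qed.

Definition code_perm (z : W) : {perm (V + V)%type} :=
  perm (@sum_op_inj (synd (left_word z)) (synd (right_word z))).

Definition code_isom (z : W) : {perm W} := Defs.isom z (code_perm z).

Lemma code_isomE (x y : W) : code_isom x y = x + permute_word (code_perm x) y.
Proof. by rewrite permE. Qed.

Lemma code_isom0 (x : W) : code_isom x 0 = x.
Proof.
by rewrite code_isomE -[RHS]addr0; congr (_ + _); apply/ffunP => i; rewrite !ffunE.
Qed.

Lemma left_word_permute (x y : W) (p : {perm V}) :
  p =1 op1 (synd (left_word x)) ->
  left_word (permute_word (code_perm x) y) = permute_word p (left_word y).
Proof.
move=> pE; apply/ffunP => i; rewrite !ffunE; congr (y _).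
by apply: (@perm_inj _ (code_perm x)); rewrite permKV permE /= -pE permKV.
Qed.

Lemma right_word_permute (x y : W) (p : {perm V}) :
  p =1 op2 (synd (right_word x)) ->
  right_word (permute_word (code_perm x) y) = permute_word p (right_word y).
Proof.
move=> pE; apply/ffunP => i; rewrite !ffunE; congr (y _).
by apply: (@perm_inj _ (code_perm x)); rewrite permKV permE /= -pE permKV.
Qed.

(** With [a] the syndrome of a half of [x], translation by [x] adds back the [a] subtracted in
    [synd_permute]; syndromes therefore multiply by the brace laws. *)
Lemma code_isom_synd (x y : W) : x \in S -> y \in S ->
  [/\ parity (left_word (code_isom x y)) = 0, parity (right_word (code_isom x y)) = 0,
      synd (left_word (code_isom x y)) = op1 (synd (left_word x)) (synd (left_word y))
    & synd (right_word (code_isom x y)) =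
        op2 (synd (right_word x)) (synd (right_word y))].
Proof.
rewrite !mem_S_code => /and3P[/eqP xl /eqP xr _] /and3P[/eqP yl /eqP yr _].
case: (br1) (br2) => _ _ I1 _ [_ _ I2 _].
have p1 := permE (I1 (synd (left_word x))).
have p2 := permE (I2 (synd (right_word x))).
rewrite code_isomE !linearD /= (left_word_permute _ p1) (right_word_permute _ p2).
rewrite !parity_permute (synd_permute br1 p1 yl) (synd_permute br2 p2 yr).
by rewrite xl xr yl yr addr0 [_ + (_ - _)]addrC subrK [_ + (_ - _)]addrC subrK.
Qed.

Lemma code_isom_stable (x y : W) : x \in S -> y \in S -> code_isom x y \in S.
Proof.
move=> xS yS; have [pl pr sl sr] := code_isom_synd xS yS.
move: xS yS; rewrite !mem_S_code pl pr sl sr !eqxx tauM /=.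
by move=> /and3P[_ _ /eqP <-] /and3P[_ _ /eqP <-].
Qed.

(** Associativity of [op1] and [op2] makes the position permutation of a product of codewords the
    composite of their permutations. Products of permutations act from left to right, whence the
    exchange of [x] and [y]. *)
Lemma code_isomM (x y : W) : x \in S -> y \in S ->
  (code_isom x * code_isom y)%g = code_isom (code_isom y x).
Proof.
move=> xS yS; apply/permP => z; rewrite permM.
have [_ _ sl sr] := code_isom_synd yS xS.
rewrite [RHS]code_isomE (_ : code_perm _ = (code_perm x * code_perm y)%g).
  rewrite !code_isomE -addrA; congr (_ + _); apply/ffunP => i.
  by rewrite !ffunE invMg permM.
case: (br1) (br2) => _ A1 _ _ [_ A2 _ _].
by apply/permP => -[i|j]; rewrite permM [in RHS]permE [in RHS]permE;
  rewrite [in LHS]permE /= ?sl ?sr ?A1 ?A2.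
Qed.

(** The map [code_isom z] sends [0] to [z]: this gives both transitivity, through the orbit of [0],
    and the order of the group, as distinct codewords give distinct maps. *)
Lemma S_code_propelinear : propelinear S.
Proof.
have S0 : 0 \in S.
  by rewrite mem_S_code !linear0 (brace_morph0 br1 br2 tauM) !eqxx.
have isom1 : code_isom 0 = 1%g.
  apply/permP => z; rewrite perm1 code_isomE add0r.
  rewrite (_ : code_perm 0 = 1%g) ?invg1.
    by apply/ffunP => i; rewrite ffunE invg1 perm1.
  apply/permP => -[i|j]; rewrite permE perm1 /= !linear0 ?(brace_left_id br1) //.
  by rewrite (brace_left_id br2).
have gG : group_set [set code_isom z | z in S].
  apply/group_setP; split; first by rewrite -isom1 imset_f.
  move=> _ _ /imsetP[x xS ->] /imsetP[y yS ->].
  by rewrite code_isomM // imset_f // code_isom_stable.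
exists (Group gG); split.
- apply/subsetP => _ /imsetP[x xS ->]; rewrite inE; apply/andP; split.
    by apply/imsetP; exists (x, code_perm x).
  rewrite eqEcard card_imset ?leqnn ?andbT; last exact: perm_inj.
  by apply/subsetP => _ /imsetP[y yS ->]; apply: code_isom_stable.
- rewrite card_imset // => x y /permP /(_ 0).
  by rewrite !code_isom0.
apply/imsetP; exists 0 => //; apply/setP => z; apply/idP/orbitP => [zS|].
  by exists (code_isom z); rewrite ?imset_f //= apermE code_isom0.
by case=> _ /imsetP[x xS ->] <-; rewrite /= apermE code_isom0.
Qed.

End Permuted.

(** * Rank and kernel *)

(** Project along [U] onto a complement and take a coordinate in which the image of [v] is
    nonzero. *)
Lemma separating_functional (K : fieldType) (Z : vectType K)
    (U : {vspace Z}) (v : Z) :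
  v \notin U ->
  exists g : Z -> K, [/\ scalar g, {in U, forall u, g u = 0} & g v != 0].
Proof.
move=> vU; have dUC : (U^C :&: U = 0)%VS by rewrite capvC capv_compl.
have UCU : (U^C + U = fullv)%VS by rewrite addvC addv_complf.
pose pi := daddv_pi U^C U.
have piE u : pi u + daddv_pi U U^C u = u.
  by rewrite daddv_pi_add // UCU memvf.
have piU u : u \in U -> pi u = 0.
  move=> uU; apply: (addIr (daddv_pi U U^C u)).
  by rewrite piE add0r daddv_pi_id // capvC.
have piv : pi v != 0.
  apply: contraNneq vU => pi0; rewrite -(piE v) pi0 add0r.
  exact: memv_pi.
have [i ci] : exists i, coord (vbasis U^C) i (pi v) != 0.
  apply/existsP; apply: contraNT piv; rewrite negb_exists => /forallP c0.
  rewrite (coord_vbasis (memv_pi _ _ v)) big1 // => i _.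
  by move: (c0 i); rewrite negbK => /eqP ->; rewrite scale0r.
exists (fun u => coord (vbasis U^C) i (pi u)); split=> // [k x y|u uU].
  by rewrite !linearP.
by rewrite piU // linear0.
Qed.

(** Such a [p] is a linear equation, written with dot products, that holds on the whole graph of
    [tau]. *)
Definition annihilates (r : nat) (tau : 'rV['F_2]_r -> 'rV['F_2]_r)
    (p : 'rV['F_2]_r * 'rV['F_2]_r) : Prop :=
  forall a, a *m p.1^T + tau a *m p.2^T = 0.

Definition period (r : nat) (tau : 'rV['F_2]_r -> 'rV['F_2]_r)
    (p : 'rV['F_2]_r * 'rV['F_2]_r) : Prop :=
  forall a, tau (a + p.1) = tau a + p.2.

Section RankKernel.
Variable r : nat.
Notation V := 'rV['F_2]_r.
Notation W := (word (V + V)%type).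

Definition pairing (p z : V * V) : 'M['F_2]_1 := z.1 *m p.1^T + z.2 *m p.2^T.

Lemma pairing_is_linear (p : V * V) : linear (pairing p).
Proof.
move=> k x y; rewrite /pairing /= !mulmxDl -!scalemxAl scalerDr.
by rewrite !addrA; congr (_ + _); rewrite -!addrA; congr (_ + _); rewrite addrC.
Qed.
HB.instance Definition _ (p : V * V) :=
  GRing.isLinear.Build 'F_2 (V * V)%type 'M['F_2]_1 _ (pairing p)
    (pairing_is_linear p).

Lemma scalar_pairing (g : V * V -> 'F_2) : scalar g ->
  exists p, forall z, pairing p z = (g z)%:M.
Proof.
move=> gP.
have gD x y : g (x + y) = g x + g y by rewrite -[x]scale1r gP mul1r scale1r.
have g0 : g 0 = 0 by apply: (addrI (g 0)); rewrite -gD !addr0.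
have gZ k x : g (k *: x) = k * g x by rewrite -[k *: x]addr0 gP g0 addr0.
exists (\row_i g (delta_mx 0 i, 0), \row_i g (0, delta_mx 0 i)) => -[a b].
apply/matrixP => i j; rewrite !ord1 !mxE /= mulr1n.
have -> : (a, b) = (a, 0) + (0, b) :> V * V.
  by congr (_, _); rewrite /= ?addr0 ?add0r.
rewrite gD {2}[a]row_sum_delta {2}[b]row_sum_delta; congr (_ + _).
  have -> : (\sum_j a 0 j *: delta_mx 0 j, 0) =
      \sum_j a 0 j *: (delta_mx 0 j, 0) :> V * V.
    elim/big_rec2: _ => // k y z _ <-.
    by congr (_, _); rewrite /= ?scaler0 ?addr0.
  rewrite (big_morph g gD g0); apply: eq_bigr => k _.
  by rewrite !mxE gZ.
have -> : (0, \sum_j b 0 j *: delta_mx 0 j) =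
    \sum_j b 0 j *: (0, delta_mx 0 j) :> V * V.
  elim/big_rec2: _ => // k y z _ <-.
  by congr (_, _); rewrite /= ?scaler0 ?addr0.
rewrite (big_morph g gD g0); apply: eq_bigr => k _.
by rewrite !mxE gZ.
Qed.

Lemma pairing_eq0 (p : V * V) : pairing p =1 (fun=> 0) -> p = 0.
Proof.
case: p => l m p0; congr (_, _); apply/rowP => i.
  have /matrixP/(_ 0 0) := p0 (delta_mx 0 i, 0).
  by rewrite /pairing /= mul0mx addr0 -rowE !mxE.
have /matrixP/(_ 0 0) := p0 (0, delta_mx 0 i).
by rewrite /pairing /= mul0mx add0r -rowE !mxE.
Qed.

Lemma dim_pairs : \dim {: (V * V)%type} = (r + r)%N.
Proof. by rewrite dimvf /dim /= !dim_matrix !mul1r. Qed.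

Variable tau : V -> V.
Hypothesis tau0 : tau 0 = 0.
Let S := S_code tau.

Definition graph : seq (V * V) := [seq (a, tau a) | a <- enum {: V}].

(** The span of the graph is the common kernel of its annihilators, here the kernel of [pairing w].
    Allowing [w = 0] treats codimensions 0 and 1 together. *)
Lemma dim_span_graph (w : V * V) :
  (forall p, annihilates tau p <-> p = 0 \/ p = w) ->
  (\dim <<graph>> + (w != 0%R) = r + r)%N.
Proof.
move=> annP; pose phi := linfun (pairing w).
have annw : annihilates tau w by apply/annP; right.
have -> : <<graph>>%VS = lker phi.
  apply/eqP; rewrite eqEsubv; apply/andP; split.
    apply/span_subvP => _ /mapP[a _ ->].
    by rewrite memv_ker lfunE /= /pairing /= annw.
  apply/subvP => v; rewrite memv_ker lfunE /= => wv0; apply/negPn/negP => vG.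
  have [g [gP gG gv]] := separating_functional vG.
  have [p pE] := scalar_pairing gP.
  have /annP pw : annihilates tau p.
    move=> a; rewrite -[LHS]/(pairing p (a, tau a)) pE gG ?scalemx0 //.
      by apply/matrixP => i j; rewrite !mxE mul0rn.
    by apply: memv_span; rewrite map_f // mem_enum.
  have : pairing p v = 0.
    case: pw => ->; last exact/eqP.
    by rewrite /pairing !trmx0 !mulmx0 addr0.
  by rewrite pE => /matrixP/(_ 0 0); rewrite !mxE mulr1n => /eqP; rewrite (negPf gv).
rewrite -dim_pairs -(limg_ker_dim phi fullv) capfv; congr (_ + _)%N.
have [w0|w0] := eqVneq w 0.
  rewrite (_ : (phi @: fullv)%VS = 0%VS) ?dimv0 //; apply/eqP; rewrite -subv0.
  apply/subvP => _ /memv_imgP[z _ ->]; rewrite memv0 lfunE /= w0.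
  by rewrite /pairing !trmx0 !mulmx0 addr0.
apply/eqP; rewrite eq_sym eqn_leq; apply/andP; split.
  by apply: leq_trans (dimvS (subvf _)) _; rewrite dimvf.
rewrite lt0n dimv_eq0; apply: contraNneq w0 => phi0; apply/eqP/pairing_eq0 => z.
have : phi z \in (phi @: fullv)%VS by rewrite memv_img ?memvf.
by rewrite phi0 memv0 lfunE => /eqP.
Qed.

Definition synds (z : W) : V * V := (synd (left_word z), synd (right_word z)).

Lemma synds_is_linear : linear synds.
Proof. by move=> k x y; rewrite /synds !linearP. Qed.
HB.instance Definition _ :=
  GRing.isLinear.Build 'F_2 W (V * V)%type _ synds synds_is_linear.

Lemma syndsD : {morph synds : x y / x + y}.
Proof. exact: linearD. Qed.

Definition parities (z : W) : ('F_2)^o * ('F_2)^o :=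
  (parity (left_word z), parity (right_word z)).

Lemma parities_is_linear : linear parities.
Proof. by move=> k x y; rewrite /parities !linearP. Qed.
HB.instance Definition _ :=
  GRing.isLinear.Build 'F_2 W (('F_2)^o * ('F_2)^o)%type _ parities
    parities_is_linear.

Let E : {vspace W} := lker (linfun parities).
Let K : {vspace W} := (E :&: lker (linfun synds))%VS.

Lemma mem_evenE (z : W) :
  (z \in E) = (parity (left_word z) == 0) && (parity (right_word z) == 0).
Proof. by rewrite memv_ker lfunE. Qed.

Lemma mem_S_codeE (z : W) :
  (z \in S) = (z \in E) && ((synds z).2 == tau (synds z).1).
Proof. by rewrite mem_S_code mem_evenE -andbA. Qed.

Lemma synds_surj (p : V * V) : exists2 z, z \in E & synds z = p.
Proof.
(* The position indexed by [0] repairs the parity without changing the syndrome. *)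
exists (concat (unit_word p.1 + unit_word 0) (unit_word p.2 + unit_word 0)).
  rewrite mem_evenE left_word_concat right_word_concat !linearD /=.
  by rewrite !parity_unit F2_addrr.
rewrite /synds left_word_concat right_word_concat !linearD /= !synd_unit !addr0.
by case: p.
Qed.

(** Two surjections account for the loss of dimension: [parities] onto dimension 2, then [synds]
    from [E] onto dimension [r + r]. The space [K] left over is the product of two extended Hamming
    codes. *)
Lemma dim_kernel : (\dim K + (r + r) + 2 = 2 ^ r.+1)%N.
Proof.
have <- : \dim {: W} = (2 ^ r.+1)%N.
  rewrite dimvf /dim /= muln1 card_sum card_mx card_Fp // mul1n.
  by rewrite expnS mul2n addnn.
rewrite -(limg_ker_dim (linfun parities) fullv) capfv.
rewrite -(limg_ker_dim (linfun synds) (lker (linfun parities))).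
congr (_ + _ + _)%N.
  rewrite -dim_pairs; congr (\dim _); apply/esym/eqP; rewrite eqEsubv subvf /=.
  apply/subvP => p _; have [z zE <-] := synds_surj p.
  by rewrite -[synds z](lfunE synds) memv_img.
rewrite (_ : limg _ = fullv) ?dimvf //; apply/eqP; rewrite eqEsubv subvf /=.
apply/subvP => -[k l] _.
suff [z <-] : exists z, parities z = (k, l).
  by rewrite -[parities z](lfunE parities) memv_img ?memvf.
exists (concat (k *: unit_word 0) (l *: unit_word 0)).
apply: (congr2 pair).
  by rewrite left_word_concat; apply: parity_scale_unit.
by rewrite right_word_concat; apply: parity_scale_unit.
Qed.

Lemma K_sub_S (z : W) : z \in K -> z \in S.
Proof.
rewrite memv_cap => /andP[zE]; rewrite memv_ker lfunE /= => /eqP z0.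
by rewrite mem_S_codeE zE z0 tau0 eqxx.
Qed.

(** Apply rank-nullity to [synds] on the span of [S]: since [K] lies in [S] and [S] in [E], the
    kernel is [K], and the image is the span of the graph. *)
Lemma rank_S_code (w : V * V) :
  (forall p, annihilates tau p <-> p = 0 \/ p = w) ->
  (rank S + (w != 0%R) + 2 = 2 ^ r.+1)%N.
Proof.
move=> /dim_span_graph dG; rewrite -dim_kernel -dG /rank; congr (_ + _)%N.
rewrite addnA; congr (_ + _)%N.
rewrite -(limg_ker_dim (linfun synds)) limg_span; congr (_ + _)%N; congr (\dim _).
  apply/eqP; rewrite eqEsubv; apply/andP; split; last first.
    apply/subvP => z zK; move: (zK); rewrite !memv_cap => /andP[_ ->].
    by rewrite andbT memv_span // mem_enum K_sub_S.
  apply: capvS => //; apply/span_subvP => z; rewrite mem_enum mem_S_codeE.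
  by case/andP.
apply: eq_span => p; apply/mapP/mapP => [[z]|[a _ ->]].
  rewrite mem_enum mem_S_codeE => /andP[_ /eqP zS] ->.
  by exists (synds z).1; rewrite ?mem_enum // -zS lfunE; apply: surjective_pairing.
have [z zE zp] := synds_surj (a, tau a).
by exists z; rewrite ?lfunE //= mem_enum mem_S_codeE zE zp eqxx.
Qed.

(** As [synds] maps [E] onto all pairs, translating [S] by [z] amounts to translating the graph by
    [synds z]; and [z] lies in [E] because [0] is in [S]. *)
Lemma mem_Ker_S_code (z : W) :
  z \in Ker S <-> z \in E /\ period tau (synds z).
Proof.
rewrite inE; split=> [/eqP zS|[zE pz]].
  have zSP y : y \in S -> z + y \in S by move=> yS; rewrite -zS imset_f.
  have S0 : 0 \in S by apply: K_sub_S; rewrite mem0v.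
  split; first by move: (zSP 0 S0); rewrite addr0 mem_S_codeE => /andP[].
  move=> a; have [y yE ya] := synds_surj (a, tau a).
  have /zSP : y \in S by rewrite mem_S_codeE yE ya eqxx.
  rewrite mem_S_codeE syndsD ya => /andP[_ /eqP zaS].
  by rewrite [RHS]addrC [a + _]addrC; apply/esym.
rewrite eqEcard card_imset ?leqnn ?andbT; last exact: addrI.
apply/subsetP => _ /imsetP[y + ->]; rewrite !mem_S_codeE syndsD => /andP[yE /eqP yS].
rewrite rpredD //; apply/eqP; have := pz (synds y).1; rewrite -yS => zyS.
apply: etrans (etrans (esym zyS) _); first exact: addrC.
by congr (tau _); apply: addrC.
Qed.

Lemma dim_Ker_S_code (k : V * V) :
  (forall p, period tau p <-> p = 0 \/ p = k) ->
  (dim_Ker S + (r + r) + 2 = 2 ^ r.+1 + (k != 0%R))%N.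
Proof.
move=> perP; rewrite -dim_kernel /dim_Ker.
rewrite (_ : \dim _ = \dim K + (k != 0%R))%N; last first.
  rewrite -(limg_ker_dim (linfun synds)) limg_span -dim_vline -span_seq1.
  congr (_ + _)%N; congr (\dim _).
    apply/eqP; rewrite eqEsubv; apply/andP; split; last first.
      apply/subvP => z zK; move: (zK); rewrite !memv_cap => /andP[zE z0].
      rewrite z0 andbT; apply: memv_span; rewrite mem_enum.
      apply/mem_Ker_S_code; split; first exact: zE.
      by apply/perP; left; move: z0; rewrite memv_ker lfunE => /eqP.
    apply: capvS => //; apply/span_subvP => z; rewrite mem_enum => /mem_Ker_S_code.
    by case.
  apply/eqP; rewrite eqEsubv; apply/andP; split; apply/span_subvP => p.
    move=> /mapP[z]; rewrite mem_enum => /mem_Ker_S_code[_ /perP pz] ->.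
    rewrite lfunE /=; case: pz => ->; first exact: mem0v.
    by rewrite memv_span // mem_head.
  rewrite inE => /eqP ->; have [z zE zk] := synds_surj k.
  rewrite -zk -[synds z](lfunE synds) memv_span // map_f // mem_enum.
  by apply/mem_Ker_S_code; split=> //; rewrite zk; apply/perP; right.
lia.
Qed.

End RankKernel.

(** * Direct products *)

(* The graph of tau spans a subspace of codimension [defect], and its group of
   periods has dimension [ker]; both are 0 or 1 in every case needed. *)
Definition admissible (r : nat) (defect ker : bool) : Prop :=
  exists (tau : 'rV['F_2]_r -> 'rV['F_2]_r) (op1 op2 : 'rV['F_2]_r -> 'rV_r -> 'rV_r),
  [/\ bijective tau, brace op1, brace op2,
      {morph tau : x y / op1 x y >-> op2 x y}
    & exists w k, [/\ (w != 0) = defect, (k != 0) = ker,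
        forall p, annihilates tau p <-> p = 0 \/ p = w
      & forall p, period tau p <-> p = 0 \/ p = k]].

Section Product.
Variables m n : nat.
Notation V := 'rV['F_2]_(m + n).

Definition prod_op (op1 : 'rV['F_2]_m -> 'rV_m -> 'rV_m)
    (op2 : 'rV['F_2]_n -> 'rV_n -> 'rV_n) (a x : V) : V :=
  row_mx (op1 (lsubmx a) (lsubmx x)) (op2 (rsubmx a) (rsubmx x)).

Definition prod_map (tau1 : 'rV['F_2]_m -> 'rV['F_2]_m)
    (tau2 : 'rV['F_2]_n -> 'rV['F_2]_n) (a : V) : V :=
  row_mx (tau1 (lsubmx a)) (tau2 (rsubmx a)).

Lemma eq_submx (x y : V) : lsubmx x = lsubmx y -> rsubmx x = rsubmx y -> x = y.
Proof. by move=> xyl xyr; rewrite -[x]hsubmxK xyl xyr hsubmxK. Qed.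

Lemma brace_prod op1 op2 : brace op1 -> brace op2 -> brace (prod_op op1 op2).
Proof.
move=> [op10 op1A op1I op1D] [op20 op2A op2I op2D].
split=> [a|a b c|a b c /eq_row_mx[/op1I bcl /op2I bcr]|a b c].
- by rewrite /prod_op !linear0 op10 op20 hsubmxK.
- by rewrite /prod_op !row_mxKl !row_mxKr op1A op2A.
- exact: eq_submx.
by apply: eq_submx; rewrite /prod_op !linearD !linearN /= !(row_mxKl, row_mxKr);
  rewrite ?op1D ?op2D.
Qed.

Lemma prod_map_bij tau1 tau2 :
  bijective tau1 -> bijective tau2 -> bijective (prod_map tau1 tau2).
Proof.
move=> [s1 t1K s1K] [s2 t2K s2K]; exists (prod_map s1 s2) => a;
  by rewrite /prod_map !row_mxKl !row_mxKr ?t1K ?t2K ?s1K ?s2K hsubmxK.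
Qed.

Variables (tau1 : 'rV['F_2]_m -> 'rV['F_2]_m) (tau2 : 'rV['F_2]_n -> 'rV['F_2]_n).
Hypotheses (tau10 : tau1 0 = 0) (tau20 : tau2 0 = 0).

(** Test an equation on vectors with one zero block: both maps fix [0], so the other block
    contributes nothing. *)
Lemma annihilates_prod (p : V * V) :
  annihilates (prod_map tau1 tau2) p <->
  annihilates tau1 (lsubmx p.1, lsubmx p.2) /\
  annihilates tau2 (rsubmx p.1, rsubmx p.2).
Proof.
pose ann1 a := a *m (lsubmx p.1)^T + tau1 a *m (lsubmx p.2)^T.
pose ann2 a := a *m (rsubmx p.1)^T + tau2 a *m (rsubmx p.2)^T.
have annE a : a *m p.1^T + prod_map tau1 tau2 a *m p.2^T =
    ann1 (lsubmx a) + ann2 (rsubmx a).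
  rewrite -{1}[a]hsubmxK -{1}[p.1]hsubmxK -{1}[p.2]hsubmxK !tr_row_mx.
  by rewrite !mul_row_col addrACA.
have ann10 : ann1 0 = 0 by rewrite /ann1 tau10 !mul0mx addr0.
have ann20 : ann2 0 = 0 by rewrite /ann2 tau20 !mul0mx addr0.
split=> [annp|[p1 p2] a]; last by rewrite annE /ann1 /ann2 p1 p2 addr0.
split=> a.
  by have := annp (row_mx a 0); rewrite annE row_mxKl row_mxKr ann20 addr0.
by have := annp (row_mx 0 a); rewrite annE row_mxKl row_mxKr ann10 add0r.
Qed.

Lemma period_prod (p : V * V) :
  period (prod_map tau1 tau2) p <->
  period tau1 (lsubmx p.1, lsubmx p.2) /\ period tau2 (rsubmx p.1, rsubmx p.2).
Proof.
split=> [perp|[p1 p2] a].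
  split=> a.
    have /(congr1 lsubmx) := perp (row_mx a 0).
    by rewrite /prod_map !linearD /= !row_mxKl.
  have /(congr1 rsubmx) := perp (row_mx 0 a).
  by rewrite /prod_map !linearD /= !row_mxKr.
by apply: eq_submx; rewrite /prod_map !linearD /= !(row_mxKl, row_mxKr) ?p1 ?p2.
Qed.

End Product.

Lemma admissible_prod m n (defect ker : bool) :
  admissible m false false -> admissible n defect ker ->
  admissible (m + n) defect ker.
Proof.
case=> tau1 [op11 [op12 [bij1 br11 br12 M1 [w1 [k1 []]]]]].
move=> /negbFE/eqP -> /negbFE/eqP -> ann1 per1.
case=> tau2 [op21 [op22 [bij2 br21 br22 M2 [w [k [<- <- ann2 per2]]]]]].
have tau10 := brace_morph0 br11 br12 M1; have tau20 := brace_morph0 br21 br22 M2.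
exists (prod_map tau1 tau2), (prod_op op11 op21), (prod_op op12 op22).
split; [exact: prod_map_bij|exact: brace_prod|exact: brace_prod| |].
  by move=> a b; rewrite /prod_map /prod_op !row_mxKl !row_mxKr M1 M2.
(* The first factor has only trivial annihilators and periods, so those of the product are those of
   the second factor, padded with zeros. *)
pose ext (p : 'rV['F_2]_n * 'rV['F_2]_n) : 'rV['F_2]_(m + n) * 'rV['F_2]_(m + n) :=
  (row_mx 0 p.1, row_mx 0 p.2).
have ext0 : ext 0 = 0 by rewrite /ext /= row_mx0.
have extI : injective ext.
  by move=> [a b] [c d] [] /= /eq_row_mx[_ ->] /eq_row_mx[_ ->].
have ext_iff (P1 P2 : _ -> Prop) q (p : 'rV['F_2]_(m + n) * 'rV['F_2]_(m + n)) :
    (forall p, P1 p <-> p = 0 \/ p = 0) -> (forall p, P2 p <-> p = 0 \/ p = q) ->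
    P1 (lsubmx p.1, lsubmx p.2) /\ P2 (rsubmx p.1, rsubmx p.2) <->
    p = 0 \/ p = ext q.
  move=> P1E P2E; rewrite P1E P2E; split=> [[p1 p2]|].
    have {p1} [pl1 pl2] : lsubmx p.1 = 0 /\ lsubmx p.2 = 0 by case: p1 => -[].
    have pE : p = ext (rsubmx p.1, rsubmx p.2).
      case: p pl1 pl2 {p2} => a b /= al bl.
      by congr (_, _); apply: eq_submx; rewrite ?row_mxKl ?row_mxKr.
    by rewrite pE -{1}ext0; case: p2 => ->; [left|right].
  by case=> ->; rewrite /= ?linear0 ?row_mxKl ?row_mxKr; split; auto;
    right; case: (q).
exists (ext w), (ext k); rewrite -ext0 !(inj_eq extI) ext0; split=> // p.
  by apply: iff_trans (annihilates_prod tau10 tau20 p) (ext_iff _ _ _ _ ann1 ann2).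
by apply: iff_trans (period_prod _ _ p) (ext_iff _ _ _ _ per1 per2).
Qed.

(** * Regular affine groups given by bit vectors *)

Section AffineGroup.
Variable n : nat.
Notation V := 'rV['F_2]_n.
Notation affine := ('M['F_2]_n * 'rV['F_2]_n)%type.

(* (A, a) is the map x |-> x A + a, and [aff_comp g h] is g after h. *)
Definition aff_comp (g h : affine) : affine := (h.1 *m g.1, h.2 *m g.1 + g.2).

(** The law is [op a x = g x], where [g] is the unique element of [G] sending [0] to [a]. Closure
    makes [a] to [g] a homomorphism, whence associativity. *)
Lemma brace_of_regular (G : seq affine) :
  {in G &, forall g h, aff_comp g h \in G} ->
  {in G, forall g, exists h, aff_comp h g = (1%:M, 0)} ->
  {in G &, injective snd} -> (forall a, exists2 g, g \in G & g.2 = a) ->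
  exists2 op, brace op & {in G, forall g x, op g.2 x = x *m g.1 + g.2}.
Proof.
move=> GM GV Ginj Gsurj.
have /fin_all_exists[e eP] : forall a, exists g, g \in G /\ g.2 = a.
  by move=> a; have [g gG ga] := Gsurj a; exists g.
have eG a : e a \in G by case: (eP a).
have e2 a : (e a).2 = a by case: (eP a).
have eK : {in G, forall g, e g.2 = g} by move=> g gG; apply: Ginj; rewrite ?e2.
pose op a x : V := x *m (e a).1 + a.
have opM a b : e (op a b) = aff_comp (e a) (e b).
  by rewrite -(eK (aff_comp _ _)) ?GM //= !e2.
exists op; last by move=> g gG x; rewrite /op eK.
split=> [a|a b c|a b c|a b c].
- by rewrite /op mul0mx add0r.
- by rewrite {3}/op opM /op /= mulmxDl mulmxA addrA.
- move=> /addIr bc; have [h /(congr1 fst) /= h1] := GV _ (eG a).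
  by rewrite -[b]mulmx1 -[c]mulmx1 -h1 !mulmxA bc.
- by rewrite /op mulmxDl addrK addrA.
Qed.

(** [T] is the graph of an isomorphism between two regular affine groups; [tau] is this isomorphism
    read on the images of [0]. *)
Lemma brace_iso_of_regular (T : seq (affine * affine)) :
  {in T &, forall p q, (aff_comp p.1 q.1, aff_comp p.2 q.2) \in T} ->
  {in T, forall p, exists q,
     (aff_comp q.1 p.1, aff_comp q.2 p.2) = ((1%:M, 0), (1%:M, 0))} ->
  {in T &, injective (fun p => p.1.2)} -> {in T &, injective (fun p => p.2.2)} ->
  (forall a, exists2 p, p \in T & p.1.2 = a) ->
  (forall a, exists2 p, p \in T & p.2.2 = a) ->
  exists tau op1 op2, [/\ bijective tau, brace op1, brace op2,
    {morph tau : x y / op1 x y >-> op2 x y}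
    & {in T, forall p, tau p.1.2 = p.2.2}].
Proof.
move=> TM TV inj1 inj2 surj1 surj2.
have /fin_all_exists[t tP] : forall a, exists p, p \in T /\ p.1.2 = a.
  by move=> a; have [p pT pa] := surj1 a; exists p.
have tT a : t a \in T by case: (tP a).
have t1 a : (t a).1.2 = a by case: (tP a).
have tK : {in T, forall p, t p.1.2 = p} by move=> p pT; apply: inj1; rewrite ?t1.
have [|||a|op1 br1 op1E] := @brace_of_regular [seq p.1 | p <- T].
- move=> _ _ /mapP[p pT ->] /mapP[q qT ->].
  by apply/mapP; eexists; first exact: TM pT qT.
- by move=> _ /mapP[p pT ->]; have [q [? ? _ _]] := TV p pT; exists q.1; congr (_, _).
- by move=> _ _ /mapP[p pT ->] /mapP[q qT ->] /inj1 ->.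
- by have [p pT <-] := surj1 a; exists p.1; rewrite ?map_f.
have [|||a|op2 br2 op2E] := @brace_of_regular [seq p.2 | p <- T].
- move=> _ _ /mapP[p pT ->] /mapP[q qT ->].
  by apply/mapP; eexists; first exact: TM pT qT.
- by move=> _ /mapP[p pT ->]; have [q [_ _ ? ?]] := TV p pT; exists q.2; congr (_, _).
- by move=> _ _ /mapP[p pT ->] /mapP[q qT ->] /inj2 ->.
- by have [p pT <-] := surj2 a; exists p.2; rewrite ?map_f.
exists (fun a => (t a).2.2), op1, op2; split=> //.
- by apply: injF_bij => a b /inj2 ab; rewrite -(t1 a) ab.
- move=> a b /=; rewrite op2E ?map_f // -[in LHS](t1 a) op1E ?map_f //.
  (* The product of [t a] and [t b] lies in [T], and its first translation part is [op1 a b]; hence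
     it is the value of [t] there. *)
  pose tab := (aff_comp (t a).1 (t b).1, aff_comp (t a).2 (t b).2).
  by rewrite -{1}(t1 b) -[_ + _]/(tab.1.2) tK ?TM.
by move=> p pT; rewrite tK.
Qed.

End AffineGroup.

(** * Computable affine maps and boolean checks *)

Section BitVectors.
Variable n : nat.
Notation bvec := (seq bool).
Notation bmx := (seq (seq bool)).
Notation baff := (seq (seq bool) * seq bool)%type.

Definition bxor (s t : bvec) : bvec :=
  mkseq (fun i => nth false s i (+) nth false t i) n.

Definition bsum (f : nat -> bool) : bool :=
  foldr (fun i b => f i (+) b) false (iota 0 n).

Definition bdot (s t : bvec) : bool :=
  bsum (fun i => nth false s i && nth false t i).

Definition bmulvm (s : bvec) (A : bmx) : bvec :=
  mkseq (fun j => bsum (fun i => nth false s i && nth false (nth [::] A i) j)) n.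

Definition bmulmm (A B : bmx) : bmx := mkseq (fun i => bmulvm (nth [::] A i) B) n.

Definition bcomp (g h : baff) : baff :=
  (bmulmm h.1 g.1, bxor (bmulvm h.2 g.1) g.2).

Definition bcomp2 (p q : baff * baff) : baff * baff :=
  (bcomp p.1 q.1, bcomp p.2 q.2).

Definition bone : baff :=
  (mkseq (fun i => mkseq (fun j => i == j) n) n, nseq n false).

(* The whole group when each generator [g] normalizes the group [H] generated by
   the previous ones and [g * g] lies in [H]. *)
Definition btable (gens : seq (baff * baff)) : seq (baff * baff) :=
  foldl (fun T g => T ++ [seq bcomp2 g t | t <- T]) [:: (bone, bone)] gens.

Definition bgraph (T : seq (baff * baff)) : seq (bvec * bvec) :=
  [seq (p.1.2, p.2.2) | p <- T].

Definition bzero : bvec * bvec := (nseq n false, nseq n false).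

(** Size and uniqueness express regularity of both projections. Each [row] is the right translate of
    [T] by [q]: its inclusion in [T] is closure, and the identity in it gives an inverse of [q]. *)
Definition bgroup_check (T : seq (baff * baff)) : bool :=
  [&& size T == 2 ^ n, uniq [seq p.1.2 | p <- T], uniq [seq p.2.2 | p <- T],
      all (fun p => (size p.1.2 == n) && (size p.2.2 == n)) T
    & all (fun q => let row := [seq bcomp2 p q | p <- T] in
                    all (mem T) row && ((bone, bone) \in row)) T]%N.

Definition bannihilates (G : seq (bvec * bvec)) (p : bvec * bvec) : bool :=
  all (fun z => ~~ (bdot z.1 p.1 (+) bdot z.2 p.2)) G.

Definition bperiod (G : seq (bvec * bvec)) (p : bvec * bvec) : bool :=
  all (fun z => (bxor z.1 p.1, bxor z.2 p.2) \in G) G.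

(** The pairs [(y.1, z.2)] run over all pairs of vectors when [G] is the graph of a bijection. For
    periods the elements of [G] suffice, since a period is the translate of the pair of zeros. *)
Definition bgraph_check (G : seq (bvec * bvec)) (w k : bvec * bvec) : bool :=
  [&& all (fun p => bannihilates G p == ((p == bzero) || (p == w)))
        [seq (y.1, z.2) | y <- G, z <- G],
      all (fun p => bperiod G p == ((p == bzero) || (p == k))) G,
      bzero \in G & k \in G].

Definition vec (s : bvec) : 'rV['F_2]_n := \row_i (nth false s i)%:R.

Definition mat (A : bmx) : 'M['F_2]_n :=
  \matrix_(i, j) (nth false (nth [::] A i) j)%:R.

Definition aff (g : baff) := (mat g.1, vec g.2).

Lemma F2_xor (b c : bool) : (b (+) c)%:R = b%:R + c%:R :> 'F_2.
Proof. by case: b c => [] []; apply/val_inj. Qed.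

Lemma bsumE (f : nat -> bool) : (bsum f)%:R = \sum_(i < n) (f i)%:R :> 'F_2.
Proof.
rewrite /bsum -(big_mkord xpredT (fun i => (f i)%:R)) /index_iota subn0.
by elim: (iota 0 n) => [|i l IHl]; rewrite ?big_nil // big_cons /= F2_xor IHl.
Qed.

Lemma vec_xor s t : vec (bxor s t) = vec s + vec t.
Proof. by apply/rowP => i; rewrite !mxE nth_mkseq // F2_xor. Qed.

Lemma vec_mulvm s A : vec (bmulvm s A) = vec s *m mat A.
Proof.
apply/rowP => j; rewrite !mxE nth_mkseq // bsumE.
by apply: eq_bigr => i _; rewrite !mxE -natrM mulnb.
Qed.

Lemma mat_mulmm A B : mat (bmulmm A B) = mat A *m mat B.
Proof.
apply/matrixP => i j; rewrite !mxE nth_mkseq // nth_mkseq // bsumE.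
by apply: eq_bigr => k _; rewrite !mxE -natrM mulnb.
Qed.

Lemma aff_bcomp g h : aff (bcomp g h) = aff_comp (aff g) (aff h).
Proof. by rewrite /aff /= mat_mulmm vec_xor vec_mulvm. Qed.

Lemma vec_nseq0 : vec (nseq n false) = 0.
Proof. by apply/rowP => i; rewrite !mxE nth_nseq if_same. Qed.

Lemma aff_bone : aff bone = (1%:M, 0).
Proof.
rewrite /aff /bone /= vec_nseq0; congr (_, _).
by apply/matrixP => i j; rewrite !mxE nth_mkseq // nth_mkseq.
Qed.

Lemma vec_inj s t : size s = n -> size t = n -> vec s = vec t -> s = t.
Proof.
move=> ss st /rowP st_eq; apply: (@eq_from_nth _ false); first by rewrite ss st.
move=> i; rewrite ss => lt_in; have := st_eq (Ordinal lt_in).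
by rewrite !mxE /=; case: (nth _ s i) (nth _ t i) => [] [].
Qed.

Lemma vec_dot s t : vec s *m (vec t)^T = (bdot s t)%:R%:M.
Proof.
apply/matrixP => i j; rewrite !ord1 !mxE mulr1n bsumE.
by apply: eq_bigr => k _; rewrite !mxE -natrM mulnb.
Qed.

Lemma uniq_map_inj (T1 T2 : eqType) (f : T1 -> T2) (s : seq T1) :
  uniq (map f s) -> {in s &, injective f}.
Proof.
elim: s => //= x s IHs /andP[xs us] y z; rewrite !inE.
case/predU1P => [->|ys] /predU1P[->|zs] //; last exact: IHs.
  by move=> fxz; move: xs; rewrite fxz map_f.
by move=> fyx; move: xs; rewrite -fyx map_f.
Qed.

(** By counting: [vec] is injective on vectors of length [n], and [X] has as many entries as the
    space has elements. *)
Lemma uniq_vec_surj (X : seq bvec) :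
  uniq X -> all (fun s => size s == n) X -> size X = (2 ^ n)%N ->
  forall a, exists2 s, s \in X & vec s = a.
Proof.
move=> uX /allP sX cX a.
suff /mapP[s sin ->] : a \in [seq vec s | s <- X] by exists s.
have uV : uniq [seq vec s | s <- X].
  rewrite map_inj_in_uniq // => s t /sX/eqP ss /sX/eqP st; exact: vec_inj.
have cV : #|'rV['F_2]_n| = size [seq vec s | s <- X].
  by rewrite size_map cX card_mx card_Fp // mul1n.
have /subset_cardP/(_ (subset_predT _)) -> // := etrans (card_uniqP uV) (esym cV).
Qed.

Definition vec2 (p : bvec * bvec) := (vec p.1, vec p.2).

Lemma admissible_of_check (T : seq (baff * baff)) (w k : bvec * bvec) :
  bgroup_check T -> bgraph_check (bgraph T) w k ->
  size w.1 = n -> size w.2 = n ->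
  admissible n (w != bzero) (k != bzero).
Proof.
case/and5P=> /eqP cT u1 u2 /allP sT /allP mT.
case/and4P=> /allP annT /allP perT G0 kG sw1 sw2.
pose aff2 (p : baff * baff) := (aff p.1, aff p.2).
have s1 : {in T, forall p, size p.1.2 = n} by move=> p /sT/andP[/eqP].
have s2 : {in T, forall p, size p.2.2 = n} by move=> p /sT/andP[_ /eqP].
have surj1 := @uniq_vec_surj [seq p.1.2 | p <- T] u1.
have surj2 := @uniq_vec_surj [seq p.2.2 | p <- T] u2.
have {}surj1 a : exists2 p, p \in T & vec p.1.2 = a.
  have [||_ /mapP[p pT ->] <-] := surj1 _ _ a; rewrite ?size_map //.
    by rewrite all_map; apply/allP => p /s1 /= ->.
  by exists p.
have {}surj2 a : exists2 p, p \in T & vec p.2.2 = a.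
  have [||_ /mapP[p pT ->] <-] := surj2 _ _ a; rewrite ?size_map //.
    by rewrite all_map; apply/allP => p /s2 /= ->.
  by exists p.
have [||||||tau [op1 [op2 [bij_tau br1 br2 tauM tauE]]]] :=
  @brace_iso_of_regular n [seq aff2 p | p <- T].
- move=> _ _ /mapP[p pT ->] /mapP[q qT ->]; rewrite -!aff_bcomp.
  apply: (map_f aff2 (x := bcomp2 p q)).
  by have /andP[/allP + _] := mT q qT; apply; apply: map_f.
- move=> _ /mapP[p pT ->]; have /andP[_ /mapP[q qT qE]] := mT p pT.
  exists (aff2 q); rewrite -!aff_bcomp -[bcomp q.1 p.1]/(bcomp2 q p).1.
  by rewrite -[bcomp q.2 p.2]/(bcomp2 q p).2 -qE aff_bone.
- move=> _ _ /mapP[p pT ->] /mapP[q qT ->] /vec_inj pq.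
  by congr (aff2 _); apply: (uniq_map_inj u1) => //; apply: pq; apply: s1.
- move=> _ _ /mapP[p pT ->] /mapP[q qT ->] /vec_inj pq.
  by congr (aff2 _); apply: (uniq_map_inj u2) => //; apply: pq; apply: s2.
- by move=> a; have [p pT <-] := surj1 a; exists (aff2 p); rewrite ?map_f.
- by move=> a; have [p pT <-] := surj2 a; exists (aff2 p); rewrite ?map_f.
have graphE : {in bgraph T, forall z, tau (vec z.1) = vec z.2}.
  by move=> _ /mapP[p pT ->]; apply: tauE (map_f aff2 pT).
have sG : {in bgraph T, forall z, size z.1 = n /\ size z.2 = n}.
  by move=> _ /mapP[p pT ->]; rewrite s1 ?s2.
have surjG a : exists2 z, z \in bgraph T & vec z.1 = a.
  by have [p pT <-] := surj1 a; exists (p.1.2, p.2.2); rewrite ?map_f.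
have surjG2 a : exists2 z, z \in bgraph T & vec z.2 = a.
  by have [p pT <-] := surj2 a; exists (p.1.2, p.2.2); rewrite ?map_f.
have vec2_inj p q : size p.1 = n -> size p.2 = n -> size q.1 = n -> size q.2 = n ->
    vec2 p = vec2 q -> p = q.
  case: p q => [s t] [s' t'] /= ss st ss' st' [/vec_inj -> // /vec_inj -> //].
have z1 : size bzero.1 = n by rewrite size_nseq.
have z2 : size bzero.2 = n by rewrite size_nseq.
have vec20 : vec2 bzero = 0 by rewrite /vec2 vec_nseq0.
have eq_vec2 p q : size p.1 = n -> size p.2 = n -> size q.1 = n -> size q.2 = n ->
    (vec2 p == vec2 q) = (p == q).
  by move=> *; apply/eqP/eqP => [/vec2_inj|->//]; apply.
have eq_iff (p q : bvec * bvec) :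
    size p.1 = n -> size p.2 = n -> size q.1 = n -> size q.2 = n ->
    (p == bzero) || (p == q) <-> vec2 p = 0 \/ vec2 p = vec2 q.
  move=> *; rewrite -vec20; split=> [/orP[]/eqP ->|[]/eqP]; auto;
    by rewrite eq_vec2 // => ->; rewrite ?orbT.
have [sk1 sk2] := sG k kG.
exists tau, op1, op2; split=> //; exists (vec2 w), (vec2 k); split.
- by rewrite -vec20 eq_vec2.
- by rewrite -vec20 eq_vec2.
- move=> [l m]; have [y yG <-] := surjG l; have [z zG <-] := surjG2 m.
  have [sy1 _] := sG y yG; have [_ sz2] := sG z zG.
  rewrite -[(vec y.1, vec z.2)]/(vec2 (y.1, z.2)) -eq_iff //.
  rewrite -(eqP (annT (y.1, z.2) _)); last by apply/allpairsP; exists (y, z).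
  have annE : {in bgraph T, forall x,
      (vec x.1 *m (vec y.1)^T + tau (vec x.1) *m (vec z.2)^T == 0) =
      ~~ (bdot x.1 y.1 (+) bdot x.2 z.2)}.
    move=> x xG; rewrite graphE // !vec_dot -raddfD -F2_xor /=.
    case: (_ (+) _); last by rewrite raddf0 eqxx.
    by apply/eqP => /matrixP/(_ 0 0); rewrite !mxE.
  split=> [ann|/allP ann a].
    by apply/allP => x xG; rewrite /= -annE //; apply/eqP/ann.
  by have [x xG <-] := surjG a; apply/eqP; rewrite annE // ann.
move=> [u v]; split=> [per|uvk].
  (* Since [tau 0 = 0], the period [(u, v)] satisfies [tau u = v]; it is thus a point of the graph,
     where the check applies. *)
  have tau0 := brace_morph0 br1 br2 tauM.
  have uE : tau u = v by rewrite -[u]add0r per tau0 add0r.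
  have [z zG zu] := surjG u.
  have zE : (u, v) = vec2 z by rewrite -uE -zu graphE.
  have [sz1 sz2] := sG z zG.
  rewrite zE -eq_iff // -(eqP (perT z zG)); apply/allP => x xG.
  have [y yG yE] := surjG (vec x.1 + vec z.1).
  suff -> : (bxor x.1 z.1, bxor x.2 z.2) = y by [].
  have [sy1 sy2] := sG y yG.
  apply: vec2_inj; rewrite ?size_mkseq // /vec2 /= !vec_xor -yE; congr (_, _).
  rewrite -[RHS]graphE // yE zu per graphE //; congr (_ + _).
  by case: zE.
have [z zG zE] : exists2 z, z \in bgraph T & vec2 z = (u, v).
  by case: uvk => ->; [exists bzero | exists k].
have [sz1 sz2] := sG z zG.
move: uvk; rewrite -zE -eq_iff // -(eqP (perT z zG)) => /allP per a.
have [x xG <-] := surjG a; have := graphE _ (per x xG).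
by rewrite /= !vec_xor => ->; rewrite graphE.
Qed.

End BitVectors.

(* Least significant bit first. *)
Definition bits (n k : nat) : seq bool := mkseq (fun i => odd (iter i half k)) n.

(* The codes of the rows of A, then the code of a, for the map x |-> x A + a. *)
Definition aff_code := (seq nat * nat)%type.

Definition decode (n : nat) (g : aff_code) : seq (seq bool) * seq bool :=
  (map (bits n) g.1, bits n g.2).

Definition decode_table (n : nat) (gens : seq (aff_code * aff_code)) :=
  btable n [seq (decode n p.1, decode n p.2) | p <- gens].

Lemma admissible_of_codes (n : nat) (gens : seq (aff_code * aff_code))
    (w k : nat * nat) :
  (let T := decode_table n gens in
   bgroup_check n T &&
   bgraph_check n (bgraph T) (bits n w.1, bits n w.2) (bits n k.1, bits n k.2)) ->
  admissible n ((bits n w.1, bits n w.2) != bzero n)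
    ((bits n k.1, bits n k.2) != bzero n).
Proof.
by case/andP=> groupT graphT; apply: admissible_of_check groupT graphT _ _;
  rewrite size_mkseq.
Qed.

(** * Explicit pairs of regular groups in dimensions 3, 4 and 5 *)

Definition codes3 : seq (aff_code * aff_code) :=
 ([:: (([:: 5; 2; 4], 6), ([:: 5; 2; 4], 6));
      (([:: 3; 2; 4], 4), ([:: 1; 6; 4], 1));
      (([:: 1; 6; 4], 1), ([:: 3; 2; 4], 4))])%N.

Definition codes4_periodic : seq (aff_code * aff_code) :=
 ([:: (([:: 1; 2; 4; 8], 8), ([:: 1; 2; 4; 8], 8));
      (([:: 5; 10; 4; 8], 6), ([:: 5; 10; 4; 8], 6));
      (([:: 7; 14; 12; 8], 13), ([:: 7; 14; 12; 8], 5));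
      (([:: 3; 2; 12; 8], 4), ([:: 9; 14; 4; 8], 1))])%N.

Definition codes4_deficient : seq (aff_code * aff_code) :=
 ([:: (([:: 1; 14; 4; 8], 1), ([:: 1; 10; 4; 8], 9));
      (([:: 1; 6; 4; 8], 5), ([:: 1; 10; 4; 8], 5));
      (([:: 1; 6; 12; 8], 2), ([:: 13; 10; 4; 8], 1));
      (([:: 1; 2; 4; 8], 8), ([:: 9; 2; 4; 8], 2))])%N.

Definition codes5 : seq (aff_code * aff_code) :=
 ([:: (([:: 1; 14; 4; 8; 16], 9), ([:: 25; 2; 12; 8; 16], 2));
      (([:: 1; 10; 4; 8; 16], 28), ([:: 1; 10; 4; 8; 16], 28));
      (([:: 1; 18; 4; 8; 16], 5), ([:: 1; 18; 4; 8; 16], 5));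
      (([:: 25; 6; 12; 8; 16], 11), ([:: 25; 14; 12; 8; 16], 7));
      (([:: 25; 2; 12; 8; 16], 2), ([:: 1; 30; 4; 8; 16], 20))])%N.

(** Both components of [codes3] generate the same dihedral group of order 8: the last two generators
    are involutions with the first as commutator. The map [tau] comes from the automorphism
    exchanging these two involutions. *)
Lemma admissible3 : admissible 3 false false.
Proof. by apply: (@admissible_of_codes 3 codes3 (0, 0) (0, 0))%N; vm_compute. Qed.

Lemma admissible4_periodic : admissible 4 false true.
Proof.
(* The code [8] is the last basis vector [e]. All linear parts fix [e], so [op1 a e = a + e] and
   likewise for [op2]; the first generator gives [tau e = e]. Hence [(e, e)] is a period. *)
by apply: (@admissible_of_codes 4 codes4_periodic (0, 0) (8, 8))%N; vm_compute.
Qed.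

Lemma admissible4_deficient : admissible 4 true false.
Proof.
(* The pair [(3, 1)] is the equation that the first two coordinates of [a] and the first one of
   [tau a] sum to zero. The functionals with codes [3] and [1] are invariant under the linear parts
   of the first and the second group, so they are homomorphisms of the group laws, and they agree on
   the generators. *)
by apply: (@admissible_of_codes 4 codes4_deficient (3, 1) (0, 0))%N; vm_compute.
Qed.

Lemma admissible5 : admissible 5 false false.
Proof. by apply: (@admissible_of_codes 5 codes5 (0, 0) (0, 0))%N; vm_compute. Qed.

(** * Passage to all dimensions and conclusion *)

Lemma admissible_add3 (n q : nat) (defect ker : bool) :
  admissible n defect ker -> admissible (q * 3 + n) defect ker.
Proof.
move=> admn; elim: q => [|q IHq] //.
by rewrite mulSn -addnA; apply: admissible_prod admissible3 IHq.
Qed.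

Lemma S_code_of_admissible (r : nat) (defect ker : bool) :
  admissible r defect ker ->
  exists tau : 'rV['F_2]_r -> 'rV['F_2]_r, bijective tau /\
    [/\ propelinear (S_code tau), extended_perfect (S_code tau),
        code_length (S_code tau) = (2 ^ r.+1)%N,
        (rank (S_code tau) + defect + 2 = 2 ^ r.+1)%N
      & (dim_Ker (S_code tau) + (r + r) + 2 = 2 ^ r.+1 + ker)%N].
Proof.
case=> tau [op1 [op2 [bij br1 br2 tauM [w [k [<- <- annP perP]]]]]].
have tau0 := brace_morph0 br1 br2 tauM.
exists tau; split=> //; split.
- exact: S_code_propelinear br1 br2 tauM.
- exact: S_code_extended_perfect.
- by rewrite /code_length card_sum card_mx card_Fp // mul1n expnS mul2n addnn.
- exact: rank_S_code.
- exact: dim_Ker_S_code.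
Qed.

Local Close Scope ring_scope.
Theorem corollary2 (r : nat) (hr : (3 <= r)%N) :
  ((r = 0 %[mod 3] \/ r = 2 %[mod 3])%N ->
     exists tau : 'rV['F_2]_r -> 'rV['F_2]_r, bijective tau /\
       [/\ propelinear (S_code tau), extended_perfect (S_code tau),
           code_length (S_code tau) = (2 ^ r.+1)%N,
           rank (S_code tau) = (2 ^ r.+1 - 2)%N
         & dim_Ker (S_code tau) = (2 ^ r.+1 - 2 * r - 2)%N])
  /\
  ((r = 1 %[mod 3])%N ->
     (exists tau : 'rV['F_2]_r -> 'rV['F_2]_r, bijective tau /\
       [/\ propelinear (S_code tau), extended_perfect (S_code tau),
           code_length (S_code tau) = (2 ^ r.+1)%N,
           rank (S_code tau) = (2 ^ r.+1 - 2)%N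
         & dim_Ker (S_code tau) = (2 ^ r.+1 - 2 * r - 1)%N])
     /\
     (exists tau : 'rV['F_2]_r -> 'rV['F_2]_r, bijective tau /\
       [/\ propelinear (S_code tau), extended_perfect (S_code tau),
           code_length (S_code tau) = (2 ^ r.+1)%N,
           rank (S_code tau) = (2 ^ r.+1 - 3)%N
         & dim_Ker (S_code tau) = (2 ^ r.+1 - 2 * r - 2)%N])).
Proof.
(* Each [r] is reached from the representative 3, 4 or 5 of its class modulo 3 by adding copies of
   the three-dimensional example. *)
have adm n (defect ker : bool) : admissible n defect ker ->
    3 <= n -> n <= r -> r = n %[mod 3] -> admissible r defect ker.
  move=> admn n3 nr rn; have -> : r = (r - n) %/ 3 * 3 + n by lia.
  exact: admissible_add3.
split=> [r02|r1].
  have /S_code_of_admissible[tau [bij [? ? ? ? ?]]] : admissible r false false.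
    case: r02 => r_mod; first by apply: adm admissible3 _ _ _.
    by apply: adm admissible5 _ _ _; lia.
  by exists tau; split=> //; split=> //; lia.
have r4 : 4 <= r by lia.
have [] := (adm _ _ _ admissible4_periodic isT r4 r1,
            adm _ _ _ admissible4_deficient isT r4 r1).
move=> /S_code_of_admissible[tau [bij [? ? ? ? dK]]].
move=> /S_code_of_admissible[tau' [bij' [? ? ? ? ?]]].
have ltr : 2 * r < 2 ^ r.+1 by rewrite expnS ltn_mul2l ltn_expl.
split; [exists tau | exists tau']; split=> //; split=> //; lia.
Qed.
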